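(* Let $\mathcal{H}$ be the underlying Heyting algebra of a bifiltration of dimensions $m\times n$, and let $\mathbb{X}_{xy}$ and $\mathbb{X}_{zw}$ be arbitrary unrelated (i.e. incomparable for $\leq$) elements of $\mathcal{H}$. Assume, without loss of generality, that $x\leq z$ and $y\geq w$. Then $$\mathbb{X}_{xy} \Rightarrow \mathbb{X}_{zw} = \begin{cases} \top=\mathbb{X}_{mn}, & \text{if } \mathbb{X}_{xy}\leq \mathbb{X}_{zw}, \\ \mathbb{X}_{zw}, & \text{if } \mathbb{X}_{zw}\leq \mathbb{X}_{xy},\\ \mathbb{X}_{mw}, & \text{otherwise.} \end{cases}$$
   Context: A Heyting algebra is a distributive lattice with least element $\perp$ in which, for all elements $a,b$, there is a greatest element $x$ satisfying $a\wedge x\leq b$; this element is denoted $a\Rightarrow b$. The greatest element is denoted $\top$. The underlying Heyting algebra $\mathcal{H}$ of a bifiltration (a filtration in two parameters) of dimensions $m\times n$ has as elements the spaces $\mathbb{X}_{ij}$ with $0\leq i\leq m$, $0\leq j\leq n$. Commutative squares of the bifiltration are assumed bicartesian, so that pushouts and pullbacks are already vertices of the original grid diagram. The lattice is thus the rectangular grid: distinct index pairs give distinct elements, $\mathbb{X}_{ij}\leq\mathbb{X}_{kl}$ if and only if $i\leq k$ and $j\leq l$, and $$\mathbb{X}_{ij}\vee\mathbb{X}_{kl}=\mathbb{X}_{\max(i,k),\max(j,l)},\qquad \mathbb{X}_{ij}\wedge\mathbb{X}_{kl}=\mathbb{X}_{\min(i,k),\min(j,l)}.$$ Its least element is $\perp=\mathbb{X}_{00}$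 and its greatest element is $\top=\mathbb{X}_{mn}$. *)

(* Defs.v *)
From HB Require Import structures.
From mathcomp Require Import all_boot all_order.
Set Implicit Arguments.
Unset Strict Implicit.
Unset Printing Implicit Defensive.
Import Order.TTheory.
Local Open Scope order_scope.

HB.mixin Record hasHeytingImpl (d : Order.disp_t) T
    of Order.BDistrLattice d T := {
  himpl : T -> T -> T;
  meet_himpl_le : forall a b : T, a `&` himpl a b <= b;
  himpl_greatest : forall a b x : T, a `&` x <= b -> x <= himpl a b
}.

(* The greatest element is definable from the mixin (it is himpl \bot \bot);
   it is part of the structure only to give access to the notation \top. *)
#[short(type="heytingType")]
HB.structure Definition Heyting (d : Order.disp_t) :=
  {T of hasHeytingImpl d T & Order.TBDistrLattice d T}.

(* The family X exhibits the Heyting algebra H as the underlying Heyting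
   algebra of a bifiltration of dimensions m x n: the elements of H are the
   spaces X i j with 0 <= i <= m and 0 <= j <= n, ordered as the grid.  The
   lemmas below derive the rest of the grid structure from this. *)
Record bifiltration_grid (m n : nat) (d : Order.disp_t) (H : heytingType d)
    (X : 'I_m.+1 -> 'I_n.+1 -> H) : Prop := BifiltrationGrid {
  grid_surj : forall a : H, exists i j, a = X i j;
  grid_le : forall i j k l, (X i j <= X k l) = (i <= k)%N && (j <= l)%N
}.

Section GridFacts.
Variables (m n : nat) (d : Order.disp_t) (H : heytingType d).
Variable X : 'I_m.+1 -> 'I_n.+1 -> H.
Hypothesis gridX : bifiltration_grid X.

Lemma grid_inj i j k l : X i j = X k l -> i = k /\ j = l.
Proof.
move=> e; have := lexx (X k l); rewrite -{1}e (grid_le gridX) => /andP[ik jl].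
have := lexx (X k l); rewrite -{2}e (grid_le gridX) => /andP[ki lj].
by split; apply/val_inj/eqP; rewrite eqn_leq ?ik ?jl.
Qed.

Lemma grid_join i j k l :
  X i j `|` X k l = X (Order.max i k) (Order.max j l).
Proof.
have leX a b a' b' : (X a b <= X a' b') = (a <= a') && (b <= b').
  exact: grid_le.
apply/le_anti; rewrite leUx !leX !le_max !lexx !orbT /=.
have [p [q e]] := grid_surj gridX (X i j `|` X k l).
have := leUl (X i j) (X k l); have := leUr (X k l) (X i j).
by rewrite e !leX !ge_max => /andP[-> ->] /andP[-> ->].
Qed.

Lemma grid_meet i j k l :
  X i j `&` X k l = X (Order.min i k) (Order.min j l).
Proof.
have leX a b a' b' : (X a b <= X a' b') = (a <= a') && (b <= b').
  exact: grid_le.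
apply/le_anti; rewrite lexI !leX !ge_min !lexx !orbT /= andbT.
have [p [q e]] := grid_surj gridX (X i j `&` X k l).
have := leIl (X i j) (X k l); have := leIr (X k l) (X i j).
by rewrite e !leX !le_min => /andP[-> ->] /andP[-> ->].
Qed.

Lemma grid_bot : \bot = X ord0 ord0.
Proof.
have [p [q e]] := grid_surj gridX \bot.
by apply/le_anti; rewrite le0x e (grid_le gridX).
Qed.

Lemma grid_top : \top = X ord_max ord_max.
Proof.
have [p [q e]] := grid_surj gridX \top.
by apply/le_anti; rewrite lex1 e (grid_le gridX) !leq_ord.
Qed.

End GridFacts.

(* Main.v *)
Require Import Defs.
From mathcomp Require Import all_boot all_order.
Import Order.TTheory.
Local Open Scope order_scope.

(** Implication is the right adjoint of meet, so [X x y => X z w] is determined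
    by the elements [X p q] with [X x y /\ X p q <= X z w].  As meets in the grid
    are coordinatewise minima, this inequality splits into [min x p <= z] and
    [min y q <= w].  When [x <= z], the first holds for every [p], so [p] may be
    pushed up to its maximum; when [w < y], the second says exactly [q <= w].
    The implication is therefore [X m w].  Incomparability supplies the strict
    inequality [w < y], and it rules out the two comparable cases. *)

Lemma le_himpl (d : Order.disp_t) (H : heytingType d) (a b c : H) :
  (c <= himpl a b) = (a `&` c <= b).
Proof.
apply/idP/idP => [le_c|]; last exact: himpl_greatest.
exact: le_trans (leI2 (lexx a) le_c) (meet_himpl_le a b).
Qed.

(** An element is determined by its lower set, and by the adjunction the lower
    set of the implication is cut out by the second coordinate alone. *)
Lemma grid_himpl (m n : nat) (d : Order.disp_t) (H : heytingType d)
    (X : 'I_m.+1 -> 'I_n.+1 -> H) (gridX : bifiltration_grid X)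
    (x z : 'I_m.+1) (y w : 'I_n.+1) :
  (x <= z)%N -> (w < y)%N -> himpl (X x y) (X z w) = X ord_max w.
Proof.
move=> le_xz lt_wy.
have lower c : (c <= himpl (X x y) (X z w)) = (c <= X ord_max w).
  have [p [q ->]] := grid_surj gridX c.
  have le_min_z : Order.min x p <= z by rewrite ge_min leEord le_xz.
  have le_min_w : (Order.min y q <= w) = (q <= w).
    by rewrite ge_min leEord leqNgt lt_wy.
  rewrite le_himpl (grid_meet gridX) !(grid_le gridX) leq_ord.
  by move: le_min_z le_min_w; rewrite !leEord => -> ->.
by apply/le_anti; rewrite -lower lexx lower lexx.
Qed.

Theorem theorem4p2 (m n : nat) (d : Order.disp_t) (H : heytingType d)
    (X : 'I_m.+1 -> 'I_n.+1 -> H) (gridX : bifiltration_grid X)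
    (x z : 'I_m.+1) (y w : 'I_n.+1)
    (unrelated : X x y >< X z w) (le_xz : (x <= z)%N) (ge_yw : (y >= w)%N) :
  \top = X ord_max ord_max /\
  himpl (X x y) (X z w) =
    if X x y <= X z w then \top
    else if X z w <= X x y then X z w
    else X ord_max w.
Proof.
split; first exact: grid_top gridX.
move: unrelated; rewrite negb_or => /andP[nle_xy nle_zw].
rewrite (negbTE nle_xy) (negbTE nle_zw).
apply: grid_himpl => //.
by move: nle_xy; rewrite (grid_le gridX) le_xz -ltnNge.
Qed.
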